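(* Let $\mu>0$ and let $h_1,h_2$ be intensity functions with $\int_0^{\infty} h_1(y)\,dy =\int_0^{\infty} h_2(y)\,dy=\infty$. If $$\lim_{x\to \infty}\frac{h_1(x)}{h_2(x)}=c$$ for some real $c>0$, then $$\lim_{x_e\to \infty}PoA(h_1, x_e)=\lim_{x_e\to \infty}PoA(h_2, x_e),$$ meaning that if one of the limits exists then so does the other, and in this case they are equal.
   Context: Fix $\mu>0$ (service rate) and $c_t>0$ (travel cost per unit distance). An intensity function is a nonnegative measurable function $h$ on $[0,\infty)$ such that $\lambda(x)=\int_0^x h(y)\,dy$ is finite for all $x\ge 0$. In the M/G/1/1 loss system, customers with distance less than $x$ from the server arrive as a Poisson process of rate $\lambda(x)$; a customer joins only if the server is idle and his distance is at most the threshold in use. The service value is $R$, the waiting cost per unit time is $c_w$, and $x_e=\frac{R\mu-c_w}{c_t\mu}>0$ is the Nash equilibrium threshold (treated as a positive parameter, with $\mu$ and $h$ fixed). The expected social benefit per unit time with threshold $x\ge 0$ is $$S(x)=\frac{c_t\int_0^x (x_e-y)h(y)\,dy}{1+\frac1\mu\int_0^x h(y)\,dy}.$$ The socially optimal threshold $x^*$ (which maximizes $S$ over $x\ge0$) is the unique $x\ge 0$ satisfying $x_e=\frac1\mu\int_0^{x}(x-y)h(y)\,dy+x$; it depends on $x_e$, $h$ and $\mu$. The price of anarchy is $$PoA(h,x_e)=\frac{S(x^* )}{S(x_e)}=\frac{\int_{0}^{x^*} (x_e-y)h(y)\,dy}{\int_{0}^{x_e} (x_e-y)h(y)\,dy}\cdot\frac{1+\frac{1}{\mu}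 \int_{0}^{x_e} h(y)\,dy}{1+\frac{1}{\mu} \int_{0}^{x^*} h(y)\,dy}$$ (defined whenever $\int_0^{x_e}h(y)\,dy>0$; $c_t$ cancels). Limits of $PoA$ are allowed to equal $+\infty$. The ratio $h_1/h_2$ is understood to be defined (i.e. $h_2(x)\neq 0$) for all sufficiently large $x$. *)

(* Defs.v *)
From HB Require Import structures.
From mathcomp Require Import all_boot all_order all_algebra.
From mathcomp Require Import all_classical all_reals all_analysis.
Set Implicit Arguments.
Unset Strict Implicit.
Unset Printing Implicit Defensive.
Import Order.TTheory GRing.Theory Num.Theory.
Import numFieldTopology.Exports numFieldNormedType.Exports.
Local Open Scope classical_set_scope.
Local Open Scope ring_scope.

(* Only the restriction of h to [0, +oo[ is relevant. *)
Definition intensity (R : realType) (h : R -> R) : Prop :=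
  [/\ measurable_fun (`[0, +oo[ : set R) h,
      (forall y : R, 0 <= y -> 0 <= h y) &
      (forall x : R, 0 <= x ->
         (\int[lebesgue_measure]_(y in `[0%R, x]) (h y)%:E < +oo)%E)].

(* Expected social benefit per unit time of the M/G/1/1 loss system in which
   customers join up to distance x; mu is the service rate, ct the travel cost
   per unit distance, xe the Nash equilibrium threshold. *)
Definition social_benefit (R : realType) (mu ct : R) (h : R -> R) (xe x : R)
    : R :=
  ct * (\int[lebesgue_measure]_(y in `[0, x]) ((xe - y) * h y))
  / (1 + mu^-1 * \int[lebesgue_measure]_(y in `[0, x]) h y).

Definition is_optimal_threshold (R : realType) (mu : R) (h : R -> R) (xe x : R)
    : Prop :=
  0 <= x /\
  xe = mu^-1 * (\int[lebesgue_measure]_(y in `[0, x]) ((x - y) * h y)) + x.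

(* For an intensity h, mu > 0 and xe >= 0, exactly one x is an optimal
   threshold: the right-hand side of the equation vanishes at 0, is continuous,
   strictly increasing and unbounded in x. The default 0 of xget is then
   irrelevant. *)
Definition optimal_threshold (R : realType) (mu : R) (h : R -> R) (xe : R)
    : R :=
  xget 0 [set x | is_optimal_threshold mu h xe x].

(* Meaningful when h has a positive integral over [0, xe]. *)
Definition PoA (R : realType) (mu ct : R) (h : R -> R) (xe : R) : R :=
  social_benefit mu ct h xe (optimal_threshold mu h xe)
  / social_benefit mu ct h xe xe.

(* Main.v *)
(* Put L(x) = \int_0^x h and G(x) = \int_0^x (x - y) h(y) dy. The equation for
   the optimal threshold x* gives S(x_e, x* ) = ct mu (x_e - x* ), whence
   PoA(x_e) = (x_e - x* ) (mu + L(x_e)) / G(x_e). As L tends to infinity, G is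
   superlinear, so x* / x_e tends to 0 and the first factor is asymptotically
   x_e, whatever the intensity. Since L1 / L2 and G1 / G2 both tend to c, the
   constants cancel and PoA(h1) / PoA(h2) tends to 1. *)
Require Import Defs.
From HB Require Import structures.
From mathcomp Require Import all_boot all_order all_algebra.
From mathcomp Require Import all_classical all_reals all_analysis.
From mathcomp Require Import measurable_realfun ring lra.
Import Order.TTheory GRing.Theory Num.Theory.
Import numFieldTopology.Exports numFieldNormedType.Exports.
Local Open Scope classical_set_scope.
Local Open Scope ring_scope.

Section Intensity.
Set Implicit Arguments.
Unset Strict Implicit.
Context (R : realType).
Local Notation leb := (@lebesgue_measure R).
Implicit Types (h k : R -> R) (a b c x y A M mu ct xe : R).

(** * Integrability of weighted intensities on bounded intervals *)

Lemma intensity_integrable h x : intensity h -> 0 <= x ->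
  leb.-integrable `[0, x] (EFin \o h).
Proof.
case=> mh h0 hfin x0; apply/integrableP; split.
  apply/measurable_EFinP; apply: measurable_funS mh => //.
  by apply: subset_itvl; rewrite bnd_simp.
rewrite [ltLHS](_ : _ = \int[leb]_(y in `[0%R, x]) (h y)%:E)%E; first exact: hfin.
apply: eq_integral => y; rewrite inE /= in_itv /= => /andP[y0 _].
by rewrite ger0_norm// h0.
Qed.

(** The continuous weight is bounded on the compact segment, and a bounded measurable factor
    preserves integrability. *)
Lemma weighted_integrable h k x : intensity h -> 0 <= x ->
  continuous k -> leb.-integrable `[0, x] (EFin \o (fun y => k y * h y)).
Proof.
move=> ih x0 ck.
have mk : measurable_fun setT k by exact: continuous_measurable_fun.
apply: (@integrableMr _ _ _ leb _ _ k (EFin \o h)) => //; first exact: measurable_funTS.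
  2: exact: intensity_integrable.
have /(@compact_bounded R R^o)[M [_ kM]] :=
  continuous_compact (continuous_subspaceT ck) (@segment_compact R 0 x).
by exists M; split; rewrite ?num_real// => N MN y yx; apply: kM => //; exists y.
Qed.

Lemma weighted_integrable_tail h k a x : intensity h -> 0 <= x -> 0 <= a ->
  continuous k -> leb.-integrable `]a, x] (EFin \o (fun y => k y * h y)).
Proof.
move=> ih x0 a0 ck.
apply: integrableS (weighted_integrable ih x0 ck) => //.
by apply: subset_itvr; rewrite bnd_simp.
Qed.

Lemma weighted_split h k a x : intensity h -> 0 <= a <= x ->
  continuous k ->
  \int[leb]_(y in `[0, x]) (k y * h y) =
  \int[leb]_(y in `[0, a]) (k y * h y) + \int[leb]_(y in `]a, x]) (k y * h y).
Proof.
move=> ih /andP[a0 ax] ck.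
rewrite -(@Rintegral_itvB _ _ (BLeft 0) (BRight x) a) ?bnd_simp//; first by ring.
exact: weighted_integrable ih (le_trans a0 ax) ck.
Qed.

(** * The arrival rate and the travel saving *)

Definition arrival_rate h x : R := \int[leb]_(y in `[0, x]) h y.

(** The function [G] of the overview; for an intensity, Fubini's theorem makes it the integral of
    [arrival_rate h] over [[0, x]]. *)
Definition travel_saving h x : R := \int[leb]_(y in `[0, x]) ((x - y) * h y).

Lemma continuous_subl x : continuous (fun y : R => x - y).
Proof. by move=> y; apply: cvgB; [exact: cvg_cst|exact: cvg_id]. Qed.

(** Presents the arrival rate as the case of weight 1, so that the results on weighted integrals
    apply to it. *)
Lemma arrival_rate1 h x :
  arrival_rate h x = \int[leb]_(y in `[0, x]) (1 * h y).
Proof. by apply: eq_Rintegral => y _; rewrite mul1r. Qed.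

Lemma arrival_rate_ge0 h x : intensity h -> 0 <= arrival_rate h x.
Proof.
by case=> _ h0 _; apply: Rintegral_ge0 => y /=; rewrite in_itv/= => /andP[/h0].
Qed.

Lemma travel_saving_ge0 h x : intensity h -> 0 <= travel_saving h x.
Proof.
case=> _ h0 _; apply: Rintegral_ge0 => y /=; rewrite in_itv/= => /andP[/h0 hy yx].
by rewrite mulr_ge0// subr_ge0.
Qed.

Lemma weighted_ge0 h k a x : intensity h -> 0 <= a ->
  (forall y, a <= y <= x -> 0 <= k y) -> 0 <= \int[leb]_(y in `]a, x]) (k y * h y).
Proof.
move=> [_ h0 _] a0 k0; apply: Rintegral_ge0 => y /=; rewrite in_itv/= => /andP[ay yx].
by rewrite mulr_ge0 ?k0 ?h0 ?yx ?(ltW ay)// (le_trans a0 (ltW ay)).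
Qed.

Lemma le_arrival_rate h a x : intensity h -> 0 <= a <= x ->
  arrival_rate h a <= arrival_rate h x.
Proof.
move=> ih ax; rewrite !arrival_rate1 (weighted_split ih ax); last exact: cst_continuous.
by rewrite lerDl weighted_ge0//; case/andP: ax.
Qed.

(** Integrates [xe - y = (xe - x) + (x - y)]. It serves both for the social benefit and for moving
    the reference point of a travel saving. *)
Lemma benefit_numerator h x xe : intensity h -> 0 <= x ->
  \int[leb]_(y in `[0, x]) ((xe - y) * h y) =
  (xe - x) * arrival_rate h x + travel_saving h x.
Proof.
move=> ih x0; rewrite /arrival_rate -RintegralZl//; last exact: intensity_integrable.
rewrite /travel_saving -RintegralD//.
- by apply: eq_Rintegral => y _; ring.
- by apply: weighted_integrable => //; exact: cst_continuous.
- by apply: weighted_integrable => //; exact: continuous_subl.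
Qed.

(** The increment is [(b - a) * arrival_rate h a] plus the integral of [(b - y) * h y] over []a,
    b]], where [0 <= b - y <= b - a]. *)
Lemma travel_saving_lip h a b : intensity h -> 0 <= a <= b ->
  0 <= travel_saving h b - travel_saving h a <= (b - a) * arrival_rate h b.
Proof.
move=> ih /[dup] ab0 /andP[a0 ab].
have b0 := le_trans a0 ab.
rewrite {1 3}/travel_saving (weighted_split ih ab0 (@continuous_subl b)).
rewrite (benefit_numerator b ih a0) addrAC addrK.
have iT := weighted_integrable_tail ih b0 a0.
have -> : arrival_rate h b = arrival_rate h a + \int[leb]_(y in `]a, b]) (1 * h y).
  by rewrite !arrival_rate1 (weighted_split ih ab0)//; exact: cst_continuous.
rewrite mulrDr addr_ge0 ?mulr_ge0 ?subr_ge0 ?arrival_rate_ge0//=; last first.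
  by apply: weighted_ge0 => // y /andP[_]; rewrite subr_ge0.
rewrite lerD2l -RintegralZl//; last exact/iT/cst_continuous.
apply: le_Rintegral => //.
- exact/iT/continuous_subl.
- have := iT (fun=> b - a) (@cst_continuous _ _ _).
  by apply: eq_integrable => // y _ /=; rewrite mul1r.
- move=> y /=; rewrite in_itv/= => /andP[ay yb].
  rewrite mul1r ler_wpM2r//; last by lra.
  by case: ih => _ + _; apply; lra.
Qed.

Lemma travel_saving_continuous h b : intensity h -> 0 <= b ->
  {within `[0, b], continuous (travel_saving h)}.
Proof.
move=> ih b0; apply/subspace_continuousP => x /=; rewrite in_itv/= => /andP[x0 xb].
apply/cvgrPdist_le => e e0.
(* Adding 1 to the Lipschitz constant makes it positive, so that [e] can be divided by it. *)
have L1 : 0 < arrival_rate h b + 1.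
  by rewrite ltr_wpDl// arrival_rate_ge0.
rewrite !near_withinE; near=> t => /=; rewrite in_itv/= => /andP[t0 tb].
have D : `|x - t| * (arrival_rate h b + 1) <= e.
  rewrite -ler_pdivlMr//; near: t.
  by apply: cvgr_dist_le; [exact: cvg_id|rewrite divr_gt0].
apply: le_trans D.
have lip u v : 0 <= u -> u <= v -> v <= b ->
    `|travel_saving h v - travel_saving h u| <= `|v - u| * (arrival_rate h b + 1).
  move=> u0 uv vb; have uv0 : 0 <= u <= v by rewrite u0.
  have /andP[T0 T1] := travel_saving_lip ih uv0.
  rewrite (ger0_norm T0) ger0_norm ?subr_ge0// (le_trans T1)// ler_wpM2l ?subr_ge0//.
  by rewrite ler_wpDr// le_arrival_rate// vb (le_trans u0).
have [tx|xt] := leP t x; first exact: lip.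
by rewrite distrC (distrC x); apply: lip => //; exact: ltW.
Unshelve. all: by end_near. Qed.

(** * The optimal threshold and a closed form of the price of anarchy *)

Lemma optimal_threshold_exists h mu xe : 0 < mu -> intensity h -> 0 <= xe ->
  exists x, is_optimal_threshold mu h xe x.
Proof.
move=> mu0 ih xe0.
pose f x := mu^-1 * travel_saving h x + x.
have cf : {within `[0, xe], continuous f}.
  have cid : {within `[0, xe], continuous (@id R)}.
    by apply: continuous_subspaceT => y; exact: cvg_id.
  move=> x; apply: cvgD (cid x).
  by apply: cvgM; [exact: cvg_cst|exact: travel_saving_continuous].
have f0 : f 0 = 0.
  by rewrite /f /travel_saving set_itv1 Rintegral_set1 mulr0 addr0.
have fxe : xe <= f xe.
  by rewrite lerDr mulr_ge0// ?invr_ge0 ?(ltW mu0)// travel_saving_ge0.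
(* The value [xe] lies between [f 0 = 0] and [f xe >= xe], so the intermediate value theorem yields
   a solution in [[0, xe]]. *)
have : Num.min (f 0) (f xe) <= xe <= Num.max (f 0) (f xe).
  by rewrite f0 ge_min xe0/= le_max fxe orbT.
move=> /(IVT xe0 cf)[x]; rewrite in_itv/= => /andP[x0 _] fx.
by exists x; split.
Qed.

Lemma optimal_thresholdP h mu xe : 0 < mu -> intensity h -> 0 <= xe ->
  is_optimal_threshold mu h xe (optimal_threshold mu h xe).
Proof.
by move=> mu0 ih xe0; apply: xgetPex; exact: optimal_threshold_exists.
Qed.

(** By the threshold equation, the numerator of the benefit at the optimum is a multiple of
    [mu + arrival_rate h x], which cancels against the denominator. *)
Lemma PoAE h mu ct xe : 0 < mu -> 0 < ct -> intensity h -> 0 <= xe ->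
  PoA mu ct h xe =
  (xe - optimal_threshold mu h xe) * (mu + arrival_rate h xe) / travel_saving h xe.
Proof.
move=> mu0 ct0 ih xe0; have [+ +] := optimal_thresholdP mu0 ih xe0.
rewrite /PoA; set x := optimal_threshold mu h xe => x0 xeE.
have {}xeE : travel_saving h x = mu * (xe - x).
  by rewrite [in RHS]xeE addrK mulrA divff ?mul1r// gt_eqF.
have den y : mu + arrival_rate h y != 0.
  by rewrite gt_eqF// ltr_wpDr// arrival_rate_ge0.
rewrite /social_benefit (benefit_numerator xe ih x0) -/(arrival_rate h x).
rewrite -/(arrival_rate h xe) -/(travel_saving h xe) xeE.
have denE y : 1 + mu^-1 * arrival_rate h y = (mu + arrival_rate h y) / mu.
  by field; rewrite gt_eqF.
rewrite !denE.
(* If the travel saving vanishes, both sides are quotients by 0, hence 0 by convention. *)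
have [->|Tn0] := eqVneq (travel_saving h xe) 0.
  by rewrite !(mulr0, mul0r, invr0).
by field; rewrite Tn0 !den !gt_eqF.
Qed.

(** * Growth and ratios at infinity *)

Lemma arrival_rate_cvgy h : intensity h ->
  (\int[leb]_(y in `[0%R, +oo[) (h y)%:E = +oo)%E ->
  arrival_rate h x @[x --> +oo] --> +oo.
Proof.
move=> ih hoo; apply/cvgryPge => A.
have [mh h0 hfin] := ih.
(* Monotone convergence along the segments [[0, n]] handles integers; monotonicity of the arrival
   rate then passes to real [x]. *)
pose F n : set R := `[0, n%:R]%classic.
have : (\int[leb]_(y in F n) (h y)%:E @[n --> \oo] -->
    \int[leb]_(y in \bigcup_n F n) (h y)%:E)%E.
  apply: ge0_nondecreasing_set_cvg_integral.
  - move=> m n mn; apply/subsetPset; apply: subset_itvl.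
    by rewrite bnd_simp ler_nat.
  - by move=> n; exact: measurable_itv.
  - move=> n; apply/measurable_EFinP; apply: measurable_funS mh => //.
    by apply: subset_itvl; rewrite bnd_simp.
  - by move=> n y; rewrite /F/= in_itv/= lee_fin => /andP[/h0].
have -> : \bigcup_n F n = `[0, +oo[%classic.
  apply/seteqP; split => y /=.
    by move=> [n _]; rewrite /F/= !in_itv/= andbT => /andP[].
  rewrite in_itv/= andbT => y0; exists (Num.truncn y).+1 => //.
  by rewrite /F/= in_itv/= y0 ltW// truncnS_gt.
rewrite hoo => /cvgeyPge /(_ A)[n _ /(_ n (leqnn _))] /= An.
near=> x.
have nx : 0 <= (n%:R : R) <= x.
  by apply/andP; split; [exact: ler0n|near: x; exact: nbhs_pinfty_ge].
apply: le_trans (le_arrival_rate ih nx).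
rewrite -lee_fin /arrival_rate /Rintegral fineK// ge0_fin_numE ?hfin//.
by apply: integral_ge0 => y /=; rewrite in_itv/= lee_fin => /andP[/h0].
Unshelve. all: by end_near. Qed.

(** The part of the integral over [[0, a]] is at least [(x - a) * arrival_rate h a]. With an arrival
    rate of at least [2 * M] at [a], and [x >= 2 * a], this is at least [M * x]. *)
Lemma travel_saving_superlinear h M : intensity h ->
  arrival_rate h x @[x --> +oo] --> +oo ->
  \forall x \near +oo, M * x <= travel_saving h x.
Proof.
move=> ih /cvgryPge Loo.
have [a a0 La] := pinfty_ex_gt0 (Loo (2 * M)).
near=> x.
have ax : 2 * a <= x by near: x; apply: nbhs_pinfty_ge; exact: num_real.
have ax0 : 0 <= a <= x by apply/andP; split; lra.
rewrite /travel_saving (weighted_split ih ax0 (@continuous_subl x)).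
rewrite (benefit_numerator x ih (ltW a0)).
have : 0 <= \int[leb]_(y in `]a, x]) ((x - y) * h y).
  by apply: weighted_ge0 => // [|y /andP[_]]; rewrite ?subr_ge0// ltW.
have := travel_saving_ge0 a ih; have := arrival_rate_ge0 a ih.
have := ler_wpM2l (ltW a0) La.
nra.
Unshelve. all: by end_near. Qed.

(* On [0, a] the crude bound [k <= K x] is enough, since [K x] is negligible
   against the integral of [h2]; on ]a, x] the ratio of the intensities is close
   to [c]. *)
Lemma weighted_ratio_cvg h1 h2 c (k : R -> R -> R) (K : R -> R) :
  intensity h1 -> intensity h2 -> 0 < c ->
  (\forall x \near +oo, h2 x != 0) -> h1 x / h2 x @[x --> +oo] --> c ->
  (forall x, continuous (k x)) ->
  (forall x y, 0 <= y <= x -> 0 <= k x y <= K x) ->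
  let H h x := \int[leb]_(y in `[0, x]) (k x y * h y) in
  (\forall x \near +oo, 0 < H h2 x) -> K x / H h2 x @[x --> +oo] --> 0 ->
  H h1 x / H h2 x @[x --> +oo] --> c.
Proof.
move=> ih1 ih2 c0 h2n0 h12 ck kK H H20 KH.
have [_ h1_ge0 _] := ih1; have [_ h2_ge0 _] := ih2.
apply/cvgrPdist_le => e e0.
have e20 : 0 < e / 2 by lra.
have close : \forall a \near +oo, forall y, a < y -> `|h1 y - c * h2 y| <= e / 2 * h2 y.
  have /cvgrPdist_le /(_ _ e20) := h12.
  move=> near1; have [a [_ aP]] := filterI near1 h2n0.
  (* The bound is kept nonnegative so that [h2 y >= 0] holds beyond it; with [h2 y != 0] this
     permits clearing the denominator. *)
  exists (Num.max a 0); split; rewrite ?num_real// => b.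
  rewrite gt_max => /andP[ab b0] y bY.
  have [] := aP y (lt_trans ab bY); rewrite /= distrC => hy hn.
  have hp : 0 < h2 y by rewrite lt_neqAle eq_sym hn h2_ge0//; lra.
  have -> : h1 y - c * h2 y = (h1 y / h2 y - c) * h2 y by field.
  by rewrite normrM (gtr0_norm hp) ler_wpM2r// ltW.
have [a a0 aP] := pinfty_ex_gt0 close.
(* [K x * C] bounds what [[0, a]] contributes to [H h1 x + c * H h2 x], hence to the difference
   [H h1 x - c * H h2 x]. *)
pose C := arrival_rate h1 a + c * arrival_rate h2 a.
have bound x : a <= x -> `|H h1 x - c * H h2 x| <= K x * C + e / 2 * H h2 x.
  move=> ax; have a0x : 0 <= a <= x by rewrite ltW.
  have x0 : 0 <= x by lra.
  have bA h : intensity h ->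
      0 <= \int[leb]_(y in `[0, a]) (k x y * h y) <= K x * arrival_rate h a.
    move=> ih; have [_ hge0 _] := ih; apply/andP; split.
      apply: Rintegral_ge0 => y /=; rewrite in_itv/= => /andP[y0 ya].
      have /kK/andP[k0 _] : 0 <= y <= x by rewrite y0 (le_trans ya).
      by rewrite mulr_ge0 ?hge0.
    rewrite -RintegralZl//; last by apply: intensity_integrable => //; exact: ltW.
    apply: le_Rintegral => //.
    - by apply: weighted_integrable => //; exact: ltW.
    - by apply: (@weighted_integrable h (fun=> K x)) => //;
        [exact: ltW|exact: cst_continuous].
    - move=> y /=; rewrite in_itv/= => /andP[y0 ya].
      have /kK/andP[_ k1] : 0 <= y <= x by rewrite y0 (le_trans ya).
      by rewrite ler_wpM2r ?hge0.
  have iT h : intensity h -> leb.-integrable `]a, x] (EFin \o (fun y => k x y * h y)).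
    by move=> ih; apply: weighted_integrable_tail => //; exact: ltW.
  have iZ h r : intensity h ->
      leb.-integrable `]a, x] (EFin \o (fun y => r * (k x y * h y))).
    move=> ih; have crk : continuous (fun y => r * k x y).
      by move=> y; apply: cvgM; [exact: cvg_cst|exact: ck].
    have := weighted_integrable_tail ih x0 (ltW a0) crk.
    by apply: eq_integrable => // y _ /=; rewrite mulrA.
  have pw y : a < y <= x ->
      (c - e / 2) * (k x y * h2 y) <= k x y * h1 y <= (c + e / 2) * (k x y * h2 y).
    move=> /andP[ay yx]; have /kK/andP[k0 _] : 0 <= y <= x by lra.
    have := aP y ay; rewrite ler_norml => /andP[lo hi].
    have lo' : (c - e / 2) * h2 y <= h1 y by lra.
    have hi' : h1 y <= (c + e / 2) * h2 y by lra.
    by rewrite !(mulrCA _ (k x y)) !ler_wpM2l.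
  rewrite /H !(weighted_split _ a0x (@ck x))//.
  set A1 := \int[leb]_(y in `[0, a]) (k x y * h1 y).
  set A2 := \int[leb]_(y in `[0, a]) (k x y * h2 y).
  set B1 := \int[leb]_(y in `]a, x]) (k x y * h1 y).
  set B2 := \int[leb]_(y in `]a, x]) (k x y * h2 y).
  have /andP[A10 A1K] : 0 <= A1 <= _ := bA _ ih1.
  have /andP[A20 A2K] : 0 <= A2 <= _ := bA _ ih2.
  have bB : (c - e / 2) * B2 <= B1 <= (c + e / 2) * B2.
    rewrite -!RintegralZl ?iT//; apply/andP; split; apply: le_Rintegral => //;
      by rewrite ?iT ?iZ// => y /=; rewrite in_itv/= => /pw/andP[].
  have B20 : 0 <= B2.
    apply: (weighted_ge0 ih2 (ltW a0)) => z /andP[az zx].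
    by have /kK/andP[] : 0 <= z <= x by rewrite zx (le_trans (ltW a0)).
  clearbody A1 A2 B1 B2.
  (* Since [A2] is nonnegative, the error [e / 2 * B2] from the tail may be enlarged to
     [e / 2 * H h2 x]. *)
  have e2A : 0 <= e / 2 * A2 by rewrite mulr_ge0// ltW.
  have cA2 : c * A2 <= c * (K x * arrival_rate h2 a) by rewrite ler_wpM2l// ltW.
  have cA20 : 0 <= c * A2 by rewrite mulr_ge0// ltW.
  rewrite /C ler_norml; move/andP: bB => [B1l B1u].
  by apply/andP; split; lra.
(* Once [K x / H h2 x] is below this constant, [K x * C] is at most [e / 2 * H h2 x], the other half
   of the error. *)
have e2C : 0 < e / 2 / (`|C| + 1) by rewrite divr_gt0// ltr_wpDl.
near=> x.
have Hx : 0 < H h2 x by near: x.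
have ax : a <= x by near: x; apply: nbhs_pinfty_ge; exact: num_real.
have Kx : `|K x / H h2 x| <= e / 2 / (`|C| + 1).
  by near: x; exact: (cvgr0_norm_le _ KH).
rewrite distrC.
have -> : H h1 x / H h2 x - c = (H h1 x - c * H h2 x) / H h2 x.
  by field; rewrite gt_eqF.
rewrite normrM normfV (gtr0_norm Hx) ler_pdivrMr// (le_trans (bound x ax))//.
have KC : K x * C <= e / 2 * H h2 x.
  move: Kx; rewrite ler_pdivlMr; last by rewrite ltr_wpDl.
  rewrite normrM normfV (gtr0_norm Hx) mulrAC ler_pdivrMr//.
  apply: le_trans; rewrite (le_trans (ler_norm _))// normrM ler_wpM2l//; lra.
lra.
Unshelve. all: by end_near. Qed.

(** The case of weight 1 and bound 1: the initial segment is negligible because the arrival rate of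
    [h2] tends to infinity. *)
Lemma arrival_rate_ratio h1 h2 c : intensity h1 -> intensity h2 -> 0 < c ->
  (\forall x \near +oo, h2 x != 0) -> h1 x / h2 x @[x --> +oo] --> c ->
  arrival_rate h2 x @[x --> +oo] --> +oo ->
  arrival_rate h1 x / arrival_rate h2 x @[x --> +oo] --> c.
Proof.
move=> ih1 ih2 c0 h20 h12 Loo.
have Lpos : \forall x \near +oo, 0 < arrival_rate h2 x.
  exact: cvgry_gt Loo 0.
have LV : 1 / arrival_rate h2 x @[x --> +oo] --> 0.
  under eq_fun do rewrite div1r.
  exact/(gtr0_cvgV0 Lpos).
have LE h : arrival_rate h = fun x => \int[leb]_(y in `[0, x]) (1 * h y).
  by apply/funext => x; exact: arrival_rate1.
rewrite !LE in Lpos LV *.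
apply: (@weighted_ratio_cvg h1 h2 c (fun _ _ => 1) (fun=> 1)) => //.
- by move=> x; exact: cst_continuous.
- by move=> x y _; rewrite ler01 lexx.
Qed.

Lemma travel_saving_gt0 h : intensity h ->
  arrival_rate h x @[x --> +oo] --> +oo ->
  \forall x \near +oo, 0 < travel_saving h x.
Proof.
move=> ih Loo; near=> x.
have x0 : 0 < x by near: x; apply: nbhs_pinfty_gt; exact: num_real.
apply: (lt_le_trans x0); rewrite -[leLHS]mul1r; near: x.
exact: travel_saving_superlinear.
Unshelve. all: by end_near. Qed.

(** The case of weight [x - y] and bound [x]: the initial segment is negligible because the travel
    saving of [h2] is superlinear. *)
Lemma travel_saving_ratio h1 h2 c : intensity h1 -> intensity h2 -> 0 < c ->
  (\forall x \near +oo, h2 x != 0) -> h1 x / h2 x @[x --> +oo] --> c ->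
  arrival_rate h2 x @[x --> +oo] --> +oo ->
  travel_saving h1 x / travel_saving h2 x @[x --> +oo] --> c.
Proof.
move=> ih1 ih2 c0 h20 h12 Loo.
have Tpos := travel_saving_gt0 ih2 Loo.
apply: (@weighted_ratio_cvg h1 h2 c (fun x y => x - y) id) => //.
- by move=> x; exact: continuous_subl.
- by move=> x y; lra.
- apply/cvgr0Pnorm_le => e e0; near=> x.
  have x0 : 0 < x by near: x; apply: nbhs_pinfty_gt; exact: num_real.
  have Tx : 0 < travel_saving h2 x by near: x.
  rewrite ger0_norm; last by rewrite divr_ge0 ?ltW.
  rewrite ler_pdivrMr// mulrC -ler_pdivrMr// mulrC; near: x.
  exact: travel_saving_superlinear.
Unshelve. all: by end_near. Qed.

(** * Comparison of the two prices of anarchy *)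

Lemma optimal_threshold_negligible h mu : 0 < mu -> intensity h ->
  arrival_rate h x @[x --> +oo] --> +oo ->
  optimal_threshold mu h xe / xe @[xe --> +oo] --> 0.
Proof.
move=> mu0 ih Loo; apply/cvgr0Pnorm_le => e e0.
(* With slope [mu / e], the threshold equation forces [x / e <= xe] whenever [x > a]; a threshold
   [x <= a] is covered by taking [xe >= a / e]. *)
have [a a0 aP] : exists2 a, 0 < a &
    forall x, a < x -> mu / e * x <= travel_saving h x.
  have [a [_ aP]] := travel_saving_superlinear (mu / e) ih Loo.
  exists (Num.max a 1); first by rewrite lt_max ltr01 orbT.
  by move=> x; rewrite gt_max => /andP[ax _]; exact: aP.
near=> xe.
have xe0 : 0 < xe by near: xe; apply: nbhs_pinfty_gt; exact: num_real.
have xea : a / e <= xe by near: xe; apply: nbhs_pinfty_ge; exact: num_real.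
have [x0 xeE] := optimal_thresholdP mu0 ih (ltW xe0).
move: x0 xeE; set x := optimal_threshold _ _ _ => x0 xeE.
rewrite ger0_norm; last by rewrite divr_ge0// ltW.
rewrite ler_pdivrMr//.
have [xa|ax] := leP x a.
  by rewrite (le_trans xa)// mulrC -ler_pdivrMr.
rewrite mulrC -ler_pdivrMr// xeE ler_wpDr//.
rewrite [leRHS]mulrC ler_pdivlMr// (le_trans _ (aP _ ax))//.
by rewrite mulrC mulrA mulrAC.
Unshelve. all: by end_near. Qed.

(** A factor tending to 1, rather than the limit of a quotient, can be multiplied with any extended
    real limit. *)
Lemma PoA_ratio h1 h2 c mu ct : 0 < mu -> 0 < ct ->
  intensity h1 -> intensity h2 -> 0 < c ->
  (\forall x \near +oo, h2 x != 0) -> h1 x / h2 x @[x --> +oo] --> c ->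
  arrival_rate h1 x @[x --> +oo] --> +oo ->
  arrival_rate h2 x @[x --> +oo] --> +oo ->
  exists2 r : R -> R, r xe @[xe --> +oo] --> (1 : R) &
  \forall xe \near +oo, PoA mu ct h1 xe = r xe * PoA mu ct h2 xe.
Proof.
move=> mu0 ct0 ih1 ih2 c0 h20 h12 L1 L2.
pose q h xe := 1 - optimal_threshold mu h xe / xe.
have q1 h : intensity h -> arrival_rate h x @[x --> +oo] --> +oo ->
    q h xe @[xe --> +oo] --> (1 : R).
  move=> ih L; rewrite -[X in _ --> X]subr0.
  apply: cvgB; first exact: cvg_cst.
  exact: optimal_threshold_negligible.
(* This is [(mu + L1) / (mu + L2)] with numerator and denominator divided by [L2], which makes its
   limit [c] visible. *)
pose s x := (arrival_rate h1 x / arrival_rate h2 x + mu / arrival_rate h2 x)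
  / (1 + mu / arrival_rate h2 x).
have Lpos : \forall x \near +oo, 0 < arrival_rate h2 x.
  exact: cvgry_gt L2 0.
have sc : s x @[x --> +oo] --> c.
  have muL : mu / arrival_rate h2 x @[x --> +oo] --> 0.
    rewrite -[X in _ --> X](mulr0 mu).
    by apply: cvgM; [exact: cvg_cst|exact/(gtr0_cvgV0 Lpos)].
  have cE : c = (c + 0) / (1 + 0) by rewrite !addr0 divr1.
  rewrite [X in _ --> X]cE.
  apply: cvgM; first by apply: cvgD muL; exact: arrival_rate_ratio.
  apply: cvgV; first by rewrite addr0 oner_neq0.
  by apply: cvgD muL; exact: cvg_cst.
(* The quotient of the two closed forms, factor by factor: [xe] cancels in the first, and the second
   tends to [c / c]. *)
exists (fun x => q h1 x / q h2 x * (s x / (travel_saving h1 x / travel_saving h2 x))).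
  have oneE : 1 = 1 / 1 * (c / c) by rewrite !divff ?oner_neq0 ?gt_eqF// mulr1.
  rewrite [X in _ --> X]oneE.
  apply: cvgM.
    by apply: cvgM (q1 _ ih1 L1) _; apply: cvgV (q1 _ ih2 L2); rewrite oner_neq0.
  apply: cvgM sc _; apply: cvgV; first by rewrite gt_eqF.
  exact: travel_saving_ratio.
have q2pos : \forall x \near +oo, 0 < q h2 x.
  exact: cvgr_gt (q1 _ ih2 L2) _ ltr01.
near=> xe.
have xe0 : 0 < xe by near: xe; apply: nbhs_pinfty_gt; exact: num_real.
have T1 : 0 < travel_saving h1 xe by near: xe; exact: travel_saving_gt0.
have T2 : 0 < travel_saving h2 xe by near: xe; exact: travel_saving_gt0.
have L20 : 0 < arrival_rate h2 xe by near: xe.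
have q20 : 0 < q h2 xe by near: xe.
have qE h : xe - optimal_threshold mu h xe = q h xe * xe.
  by rewrite /q; field; rewrite gt_eqF.
rewrite !PoAE ?(ltW xe0)// !qE /s.
field.
by rewrite !gt_eqF//; lra.
Unshelve. all: by end_near. Qed.

Lemma PoA_cvg_imp h1 h2 c mu ct (l : \bar R) : 0 < mu -> 0 < ct ->
  intensity h1 -> intensity h2 -> 0 < c ->
  (\forall x \near +oo, h2 x != 0) -> h1 x / h2 x @[x --> +oo] --> c ->
  arrival_rate h1 x @[x --> +oo] --> +oo ->
  arrival_rate h2 x @[x --> +oo] --> +oo ->
  (PoA mu ct h2 xe)%:E @[xe --> +oo] --> l ->
  (PoA mu ct h1 xe)%:E @[xe --> +oo] --> l.
Proof.
move=> mu0 ct0 ih1 ih2 c0 h20 h12 L1 L2 P2l.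
have [r r1 rP] := PoA_ratio mu0 ct0 ih1 ih2 c0 h20 h12 L1 L2.
rewrite -[l]mul1e.
apply: (@cvg_trans _ (((r xe)%:E * (PoA mu ct h2 xe)%:E)%E @[xe --> +oo])).
  by apply: near_eq_cvg; apply: filterS rP => xe ->; rewrite EFinM.
(* The product [1 * l] is never indeterminate, even for infinite [l]. *)
apply: cvgeM P2l; last by apply: cvg_EFin r1; exact: nearW.
by rewrite /mule_def; case: (l) => //; rewrite oner_neq0.
Qed.

End Intensity.

Theorem theorem3p11 (R : realType) (mu ct : R) (h1 h2 : R -> R) (c : R)
    (mu_gt0 : 0 < mu) (ct_gt0 : 0 < ct)
    (h1_intensity : intensity h1) (h2_intensity : intensity h2)
    (h1_infinite :
      (\int[lebesgue_measure]_(y in `[0%R, +oo[) (h1 y)%:E = +oo)%E)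
    (h2_infinite :
      (\int[lebesgue_measure]_(y in `[0%R, +oo[) (h2 y)%:E = +oo)%E)
    (h2_neq0 : \forall x \near +oo_R, h2 x != 0)
    (c_gt0 : 0 < c)
    (ratio_lim : (h1 x / h2 x) @[x --> +oo_R] --> c) :
  forall l : \bar R,
    (PoA mu ct h1 xe)%:E @[xe --> +oo_R] --> l <->
    (PoA mu ct h2 xe)%:E @[xe --> +oo_R] --> l.
Proof.
have L1 := arrival_rate_cvgy h1_intensity h1_infinite.
have L2 := arrival_rate_cvgy h2_intensity h2_infinite.
move=> l; split; last first.
  exact: (PoA_cvg_imp mu_gt0 ct_gt0 h1_intensity h2_intensity c_gt0).
(* The other implication exchanges the two intensities, with limit ratio [c^-1]. *)
have inv_lim : h2 x / h1 x @[x --> +oo] --> c^-1.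
  under eq_fun do rewrite -invf_div.
  by apply: cvgV ratio_lim; rewrite gt_eqF.
(* As [c] is nonzero, the ratio is eventually nonzero, and so is its numerator. *)
have h1_neq0 : \forall x \near +oo, h1 x != 0.
  apply: filterS (cvgr_neq0 _ ratio_lim (lt0r_neq0 c_gt0)) => x.
  by apply: contra => /eqP ->; rewrite mul0r.
have cV_gt0 : 0 < c^-1 by rewrite invr_gt0.
exact: (PoA_cvg_imp mu_gt0 ct_gt0 h2_intensity h1_intensity cV_gt0).
Qed.
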